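(* For every $\lambda>0$, $(\mathfrak g_4,S_1^\lambda,J)$ is not a first kind algebraic Ricci soliton associated to $\nabla^1$: there do not exist $c\in\mathbb R$ and a derivation $D$ of $\mathfrak g_4$ such that $\operatorname{Ric}^1=c\operatorname{Id}+D$.
   Context: $\mathfrak g_4$ is the real Lie algebra with basis $e_1,e_2,e_3,e_4$ and non-zero brackets (up to skew-symmetry) $[e_1,e_2]=e_3$, $[e_1,e_3]=e_4$. For $\lambda>0$, $S_1^\lambda$ is the Lorentzian inner product $\langle\cdot,\cdot\rangle$ on $\mathfrak g_4$ whose matrix in $(e_1,e_2,e_3,e_4)$ is $\begin{bmatrix}1&0&0&0\\0&0&0&1\\0&0&\lambda&0\\0&1&0&0\end{bmatrix}$. Fix the basis $v_1=e_1$, $v_2=\frac1{\sqrt\lambda}e_3$, $v_3=\frac1{\sqrt2}(e_2+e_4)$, $v_4=\frac1{\sqrt2}(e_2-e_4)$, which is orthonormal: $\langle v_i,v_j\rangle=0$ for $i\ne j$, $\langle v_i,v_i\rangle=1$ for $i=1,2,3$, $\langle v_4,v_4\rangle=-1$. The product structure $J$ is the linear map with $Jv_i=v_i$ for $i=1,2,3$ and $Jv_4=-v_4$. Write $\mathfrak g$ for the Lie algebra. The Levi-Civita connection is the bilinear map $\nabla:\mathfrak g\times\mathfrak g\to\mathfrak g$ with $2\langle\nabla_uv,w\rangle=\langle[u,v],w\rangle+\langle[w,u],v\rangle+\langle[w,v],u\rangle$ for all $u,v,w$. Put $(\nabla_uJ)v=\nabla_u(Jv)-J(\nabla_uv)$.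 The canonical connection is $\nabla^0_uv=\nabla_uv-\frac12(\nabla_uJ)Jv$, and the Kobayashi-Nomizu connection is $\nabla^1_uv=\nabla^0_uv-\frac14\left[(\nabla_vJ)Ju-(\nabla_{Jv}J)u\right]$. The curvature of $\nabla^1$ is $R^1_{uv}w=\nabla^1_{[u,v]}w-\nabla^1_u\nabla^1_vw+\nabla^1_v\nabla^1_uw$, and its Ricci operator is $\operatorname{Ric}^1(u)=\sum_{k=1}^4\langle v_k,v_k\rangle R^1_{v_ku}v_k$. A derivation of $\mathfrak g$ is a linear map $D:\mathfrak g\to\mathfrak g$ with $[D(u),v]+[u,D(v)]=D[u,v]$ for all $u,v\in\mathfrak g$. *)

(* Defs.v *)
From HB Require Import structures.
From mathcomp Require Import all_boot all_order all_algebra.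
From mathcomp Require Import ring.
From mathcomp Require Import reals.

Set Implicit Arguments.
Unset Strict Implicit.
Unset Printing Implicit Defensive.

Import Order.TTheory GRing.Theory Num.Theory.
Local Open Scope ring_scope.

Section MetricLieAlgebras.
Variables (R : realType) (V : lmodType R).
Variables (br : V -> V -> V) (ip : V -> V -> R).

Definition koszul (u v w : V) : R :=
  ip (br u v) w + ip (br w u) v + ip (br w v) u.

Definition is_levi_civita (nabla : {bilinear V -> V -> V}) : Prop :=
  forall u v w, 2 * ip (nabla u v) w = koszul u v w.

(* [cov_deriv nabla J u v] is $(\nabla_u J) v$. *)
Definition cov_deriv (nabla : V -> V -> V) (J : V -> V) (u v : V) : V :=
  nabla u (J v) - J (nabla u v).

Definition canonical_connection (nabla : V -> V -> V) (J : V -> V) (u v : V)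
    : V :=
  nabla u v - 2^-1 *: cov_deriv nabla J u (J v).

Definition kobayashi_nomizu_connection (nabla : V -> V -> V) (J : V -> V)
    (u v : V) : V :=
  canonical_connection nabla J u v
  - 4^-1 *: (cov_deriv nabla J v (J u) - cov_deriv nabla J (J v) u).

(* Sign convention: this is the opposite of
   $[\nabla_u, \nabla_v] - \nabla_{[u,v]}$. *)
Definition curvature (conn : V -> V -> V) (u v w : V) : V :=
  conn (br u v) w - conn u (conn v w) + conn v (conn u w).

Definition ricci_operator (n : nat) (frame : 'I_n -> V) (conn : V -> V -> V)
    (u : V) : V :=
  \sum_(k < n) ip (frame k) (frame k) *: curvature conn (frame k) u (frame k).

Definition is_derivation (D : {linear V -> V}) : Prop :=
  forall u v, br (D u) v + br u (D v) = D (br u v).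

Definition first_kind_algebraic_ricci_soliton (n : nat) (frame : 'I_n -> V)
    (conn : V -> V -> V) : Prop :=
  exists (c : R) (D : {linear V -> V}),
    is_derivation D /\ forall u, ricci_operator frame conn u = c *: u + D u.

End MetricLieAlgebras.

(* $\mathfrak g_4$ is modelled on row vectors, with indices starting at 0:
   $e_1, e_2, e_3, e_4$ are ['e_0], ['e_1], ['e_2], ['e_3], and similarly
   $v_1, v_2, v_3, v_4$ are [v_frame lambda 0], ..., [v_frame lambda 3]. *)
Section G4.
Variable R : realType.
Local Notation g4 := 'rV[R]_4.

(* Bilinear extension of $[e_1,e_2] = -[e_2,e_1] = e_3$ and
   $[e_1,e_3] = -[e_3,e_1] = e_4$. *)
Definition g4_bracket (u v : g4) : g4 :=
  (u 0 0 * v 0 1 - u 0 1 * v 0 0) *: 'e_2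
  + (u 0 0 * v 0 2 - u 0 2 * v 0 0) *: 'e_3.

Definition S1_mx (lambda : R) : 'M[R]_4 :=
  \matrix_(i < 4, j < 4)
    nth 0 (nth [::] [:: [:: 1; 0; 0;      0];
                        [:: 0; 0; 0;      1];
                        [:: 0; 0; lambda; 0];
                        [:: 0; 1; 0;      0]] i) j.

Definition S1 (lambda : R) (u v : g4) : R := (u *m S1_mx lambda *m v^T) 0 0.

Definition v_frame (lambda : R) (k : 'I_4) : g4 :=
  nth 0 [:: 'e_0;
            (Num.sqrt lambda)^-1 *: 'e_2;
            (Num.sqrt 2)^-1 *: ('e_1 + 'e_3);
            (Num.sqrt 2)^-1 *: ('e_1 - 'e_3)] k.

Definition is_product_structure (lambda : R) (J : {linear g4 -> g4}) : Prop :=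
  [/\ J (v_frame lambda 0) = v_frame lambda 0,
      J (v_frame lambda 1) = v_frame lambda 1,
      J (v_frame lambda 2) = v_frame lambda 2
    & J (v_frame lambda 3) = - v_frame lambda 3].

Lemma sum4 (V : nmodType) (F : 'I_4 -> V) :
  \sum_(i < 4) F i = F 0 + F 1 + F 2 + F 3.
Proof.
rewrite !big_ord_recr big_ord0 /= add0r.
by congr (F _ + F _ + F _ + F _); apply: val_inj.
Qed.

Lemma g4P (u v : g4) :
  u 0 0 = v 0 0 -> u 0 1 = v 0 1 -> u 0 2 = v 0 2 -> u 0 3 = v 0 3 -> u = v.
Proof.
move=> h0 h1 h2 h3; apply/rowP => -[[|[|[|[|//]]]] h].
- by rewrite (_ : Ordinal h = 0) //; apply: val_inj.
- by rewrite (_ : Ordinal h = 1) //; apply: val_inj.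
- by rewrite (_ : Ordinal h = 2) //; apply: val_inj.
- by rewrite (_ : Ordinal h = 3) //; apply: val_inj.
Qed.

Lemma S1E lambda (u v : g4) :
  S1 lambda u v = u 0 0 * v 0 0 + u 0 1 * v 0 3 + lambda * u 0 2 * v 0 2
                  + u 0 3 * v 0 1.
Proof. by rewrite /S1 mxE sum4 !mxE !sum4 !mxE /=; ring. Qed.

Lemma g4_bracketE (u v : g4) :
  [/\ g4_bracket u v 0 0 = 0, g4_bracket u v 0 1 = 0,
      g4_bracket u v 0 2 = u 0 0 * v 0 1 - u 0 1 * v 0 0
    & g4_bracket u v 0 3 = u 0 0 * v 0 2 - u 0 2 * v 0 0].
Proof. by split; rewrite /g4_bracket !mxE /=; ring. Qed.

Lemma g4_bracket_table :
  [/\ g4_bracket 'e_0 'e_1 = 'e_2, g4_bracket 'e_0 'e_2 = 'e_3,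
      g4_bracket 'e_0 'e_3 = 0, g4_bracket 'e_1 'e_2 = 0
    & g4_bracket 'e_1 'e_3 = 0 /\ g4_bracket 'e_2 'e_3 = 0].
Proof. by do ! split; apply: g4P; rewrite /g4_bracket !mxE /=; ring. Qed.

Lemma g4_bracket_bilinear : bilinear_for *:%R *:%R g4_bracket.
Proof.
by split=> w a u v; apply: g4P; rewrite /g4_bracket /= !mxE /=; ring.
Qed.

Lemma g4_bracketxx (u : g4) : g4_bracket u u = 0.
Proof. by apply: g4P; rewrite /g4_bracket !mxE /=; ring. Qed.

Lemma g4_jacobi (u v w : g4) :
  g4_bracket u (g4_bracket v w) + g4_bracket v (g4_bracket w u)
  + g4_bracket w (g4_bracket u v) = 0.
Proof. by apply: g4P; rewrite /g4_bracket !mxE /=; ring. Qed.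

Lemma v_frame_orthonormal (lambda : R) (i j : 'I_4) : 0 < lambda ->
  S1 lambda (v_frame lambda i) (v_frame lambda j)
  = if i == j then if i == 3 then - 1 else 1 else 0.
Proof.
move=> l0.
have sl : lambda * (Num.sqrt lambda)^-1 ^+ 2 = 1.
  by rewrite exprVn sqr_sqrtr ?ltW // divff ?gt_eqF.
have s2 : 2 * (Num.sqrt 2)^-1 ^+ 2 = 1 :> R.
  by rewrite exprVn sqr_sqrtr ?ler0n // divff // pnatr_eq0.
case: i => [[|[|[|[|//]]]] hi]; case: j => [[|[|[|[|//]]]] hj];
  rewrite S1E /v_frame /= !mxE /=; try ring.
- by rewrite -[RHS]sl; ring.
- by rewrite -[RHS]s2; ring.
- by rewrite -[X in _ = - X]s2; ring.
Qed.

Lemma product_structure_exists (lambda : R) :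
  exists J : {linear g4 -> g4}, is_product_structure lambda J.
Proof.
exists (mulmxr (S1_mx 1)).
by split; apply: g4P; rewrite /v_frame /= !mxE !sum4 !mxE /=; ring.
Qed.

Section LeviCivita.
Variable lambda : R.

Definition levi_civita_sol (u v : g4) : g4 :=
  (2^-1 * (1 + lambda) * (u 0 1 * v 0 2 + u 0 2 * v 0 1)) *: 'e_0
  + (2^-1 * (u 0 0 * v 0 1 - u 0 1 * v 0 0
             - lambda^-1 * (u 0 0 * v 0 1 + u 0 1 * v 0 0))) *: 'e_2
  + (2^-1 * (u 0 0 * v 0 2 - u 0 2 * v 0 0
             - lambda * (u 0 0 * v 0 2 + u 0 2 * v 0 0))) *: 'e_3.

Lemma levi_civita_sol_bilinear : bilinear_for *:%R *:%R levi_civita_sol.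
Proof.
by split=> w a u v; apply: g4P; rewrite /levi_civita_sol /= !mxE /=; ring.
Qed.

Lemma koszulE (u v w : g4) : koszul g4_bracket (S1 lambda) u v w =
  lambda * ((u 0 0 * v 0 1 - u 0 1 * v 0 0) * w 0 2
            + (w 0 0 * u 0 1 - w 0 1 * u 0 0) * v 0 2
            + (w 0 0 * v 0 1 - w 0 1 * v 0 0) * u 0 2)
  + (u 0 0 * v 0 2 - u 0 2 * v 0 0) * w 0 1
  + (w 0 0 * u 0 2 - w 0 2 * u 0 0) * v 0 1
  + (w 0 0 * v 0 2 - w 0 2 * v 0 0) * u 0 1.
Proof.
rewrite /koszul !S1E.
have [-> -> -> ->] := g4_bracketE u v.
have [-> -> -> ->] := g4_bracketE w u.
have [-> -> -> ->] := g4_bracketE w v.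
ring.
Qed.

HB.instance Definition _ :=
  bilinear_isBilinear.Build R g4 g4 g4 *:%R *:%R levi_civita_sol
    levi_civita_sol_bilinear.

Lemma levi_civita_exists : 0 < lambda ->
  exists nabla : {bilinear g4 -> g4 -> g4},
    is_levi_civita g4_bracket (S1 lambda) nabla.
Proof.
move=> l0; exists levi_civita_sol => u v w.
rewrite koszulE S1E /= /levi_civita_sol !mxE /=.
by field; rewrite gt_eqF.
Qed.

Lemma levi_civita_unique (nabla nabla' : {bilinear g4 -> g4 -> g4}) :
  0 < lambda ->
  is_levi_civita g4_bracket (S1 lambda) nabla ->
  is_levi_civita g4_bracket (S1 lambda) nabla' -> nabla =2 nabla'.
Proof.
move=> l0 h h' u v.
have H w : S1 lambda (nabla u v) w = S1 lambda (nabla' u v) w.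
  by apply: (@mulfI _ 2); rewrite ?h ?h' ?pnatr_eq0.
move: (H 'e_0) (H 'e_1) (H 'e_2) (H 'e_3); rewrite !S1E !mxE /=.
rewrite !mulr0 !mulr1 !addr0 !add0r => h0 h3 /(mulfI (lt0r_neq0 l0)) h2 h1.
exact: g4P.
Qed.

End LeviCivita.
End G4.

(* Main.v *)
Require Import Defs.
From mathcomp Require Import all_boot all_order all_algebra.
From mathcomp Require Import ring lra.
From mathcomp Require Import reals.

Set Implicit Arguments.
Unset Strict Implicit.
Unset Printing Implicit Defensive.

Import Order.TTheory GRing.Theory Num.Theory.
Local Open Scope ring_scope.

(* A derivation D satisfies D e_4 = D [e_1, e_3] in [g, g] = span(e_3, e_4), so
   D e_4 has no e_2-component.  But Ric^1 e_4 has e_2-component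
   (lambda + 1 / lambda) / 8 > 0, and c e_4 does not contribute to it. *)

Section G4.
Variables (R : realType) (lambda : R).
Hypothesis lambda_gt0 : 0 < lambda.
Local Notation g4 := 'rV[R]_4.

(** Trades the abstract [nabla] for an explicit formula: [levi_civita_sol] satisfies the Koszul
    identity, which has only one solution because [S1] is nondegenerate. *)
Lemma levi_civitaE (nabla : {bilinear g4 -> g4 -> g4}) :
  is_levi_civita (@g4_bracket R) (S1 lambda) nabla ->
  nabla =2 levi_civita_sol lambda.
Proof.
move=> Hnabla; apply: (levi_civita_unique lambda_gt0 Hnabla) => u v w.
rewrite koszulE S1E /= /levi_civita_sol !mxE /=.
by field; rewrite gt_eqF.
Qed.

Lemma g4_basisE (u : g4) :
  u = u 0 0 *: 'e_0 + u 0 1 *: 'e_1 + u 0 2 *: 'e_2 + u 0 3 *: 'e_3.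
Proof. by apply: g4P; rewrite !mxE /=; ring. Qed.

(** Fixing e_2 + e_4 and negating e_2 - e_4 amounts to exchanging e_2 and e_4; the normalising
    factors of the frame cancel. *)
Lemma product_structureE (J : {linear g4 -> g4}) (u : g4) :
  is_product_structure lambda J ->
  [/\ J u 0 0 = u 0 0, J u 0 1 = u 0 3, J u 0 2 = u 0 2 & J u 0 3 = u 0 1].
Proof.
case; rewrite /v_frame /= => J0 J1 J2 J3.
have J_e2 : J 'e_2 = 'e_2.
  move: J1; rewrite linearZ => /scalerI; apply.
  by rewrite invr_eq0 gt_eqF // sqrtr_gt0.
have sqrt2_neq0 : (Num.sqrt 2)^-1 != 0 :> R.
  by rewrite invr_eq0 gt_eqF // sqrtr_gt0.
have J_add : J 'e_1 + J 'e_3 = 'e_1 + 'e_3.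
  by rewrite -linearD; apply: (scalerI sqrt2_neq0); rewrite -linearZ.
have J_sub : J 'e_1 - J 'e_3 = - ('e_1 - 'e_3).
  by rewrite -linearB; apply: (scalerI sqrt2_neq0); rewrite -linearZ scalerN.
have coordJ j : J u 0 j = u 0 0 * ('e_0 : g4) 0 j + u 0 1 * J 'e_1 0 j
    + u 0 2 * ('e_2 : g4) 0 j + u 0 3 * J 'e_3 0 j.
  by rewrite {1}[u]g4_basisE !linearD !linearZ /= J0 J_e2 !mxE.
(* Read coordinatewise, the two relations form a real linear system that [lra] can solve. *)
have addE j := congr1 (fun w : g4 => w 0 j) J_add.
have subE j := congr1 (fun w : g4 => w 0 j) J_sub.
have J_e1 j : J 'e_1 0 j = ('e_3 : g4) 0 j.
  by have := addE j; have := subE j; rewrite !mxE; lra.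
have J_e3 j : J 'e_3 0 j = ('e_1 : g4) 0 j.
  by have := addE j; rewrite !mxE J_e1 !mxE; lra.
by split; rewrite coordJ J_e1 J_e3 !mxE /=; ring.
Qed.

Section Connection.
Variables (J : {linear g4 -> g4}) (nabla : {bilinear g4 -> g4 -> g4}).
Hypothesis HJ : is_product_structure lambda J.
Hypothesis Hnabla : is_levi_civita (@g4_bracket R) (S1 lambda) nabla.
Let conn := kobayashi_nomizu_connection nabla J.

(** In the frame, v_4 is parallel (v enters only through its coordinates 0 and 2 and the sum of
    coordinates 1 and 3) and no value has a v_4-component (coordinates 1 and 3 agree). *)
Lemma kobayashi_nomizuE (u v : g4) :
  [/\ conn u v 0 0
      = 4^-1 * (1 + lambda) * ((u 0 1 + u 0 3) * v 0 2
                               + u 0 2 * (v 0 1 + v 0 3)),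
      conn u v 0 1
      = 4^-1 * ((1 - lambda) * u 0 0 * v 0 2 - (1 + lambda) * u 0 2 * v 0 0),
      conn u v 0 2
      = 4^-1 * ((1 - lambda^-1) * (u 0 0 * (v 0 1 + v 0 3) + u 0 3 * v 0 0)
                - (3 + lambda^-1) * u 0 1 * v 0 0)
    & conn u v 0 3
      = 4^-1 * ((1 - lambda) * u 0 0 * v 0 2 - (1 + lambda) * u 0 2 * v 0 0)].
Proof.
have nablaE := levi_civitaE Hnabla.
have J0 w : J w 0 0 = w 0 0 by have [] := product_structureE w HJ.
have J1 w : J w 0 1 = w 0 3 by have [] := product_structureE w HJ.
have J2 w : J w 0 2 = w 0 2 by have [] := product_structureE w HJ.
have J3 w : J w 0 3 = w 0 1 by have [] := product_structureE w HJ.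
have JE := (J0, J1, J2, J3).
split; rewrite /conn /kobayashi_nomizu_connection /canonical_connection;
  rewrite /cov_deriv !nablaE !mxE !JE /levi_civita_sol !mxE !JE /=;
  by field; rewrite gt_eqF.
Qed.

(** Since e_4 is central, the term in [u, e_4] vanishes; since e_4 has no e_1- or e_3-component,
    differentiating along it gives no e_2-component. Only the term with e_4 as inner direction
    survives. *)
Lemma curvature_e3_coord1 (u : g4) :
  curvature (@g4_bracket R) conn u 'e_3 u 0 1
  = 16^-1 * ((1 + lambda) ^+ 2 * u 0 2 ^+ 2
             - (1 - lambda) * (1 - lambda^-1) * u 0 0 ^+ 2).
Proof.
have connE := kobayashi_nomizuE; clearbody conn.
have conn1 x y : conn x y 0 1
    = 4^-1 * ((1 - lambda) * x 0 0 * y 0 2 - (1 + lambda) * x 0 2 * y 0 0).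
  by have [] := connE x y.
(* By [conn1], the outer derivative sees only coordinates 0 and 2 of the inner one. *)
have [e3u0 _ e3u2 _] := connE 'e_3 u.
have [br0 _ br2 _] := g4_bracketE u 'e_3.
have coordD (x y : g4) : (x + y) 0 1 = x 0 1 + y 0 1 by rewrite mxE.
have coordN (x : g4) : (- x) 0 1 = - x 0 1 by rewrite mxE.
rewrite /curvature 2!coordD coordN !conn1 br0 br2 e3u0 e3u2.
by rewrite !mxE /=; field; rewrite gt_eqF.
Qed.

(** The vectors v_3 and v_4 have no e_1- or e_3-component and contribute nothing. The contributions
    of v_1 and v_2 are 1/16 of lambda + 1/lambda - 2 and of lambda + 1/lambda + 2, so the constants
    cancel. *)
Lemma ricci_e3_coord1 :
  ricci_operator (@g4_bracket R) (S1 lambda) (v_frame lambda) conn 'e_3 0 1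
  = 8^-1 * (lambda + lambda^-1).
Proof.
have s2 : (Num.sqrt lambda)^-1 ^+ 2 = lambda^-1.
  by rewrite exprVn sqr_sqrtr // ltW.
have curvE := curvature_e3_coord1; clearbody conn.
have coordD (x y : g4) : (x + y) 0 1 = x 0 1 + y 0 1 by rewrite mxE.
have coordN (x : g4) : (- x) 0 1 = - x 0 1 by rewrite mxE.
rewrite /ricci_operator sum4 !v_frame_orthonormal //= !scale1r scaleN1r.
rewrite 3!coordD coordN !curvE /v_frame /= !mxE /= addr0 subr0 !mulr0 !mulr1 s2.
by field; rewrite gt_eqF.
Qed.

End Connection.

Lemma derivation_e3_coord1 (D : {linear g4 -> g4}) :
  is_derivation (@g4_bracket R) D -> D 'e_3 0 1 = 0.
Proof.
have [_ <- _ _ _] := g4_bracket_table R; move=> <-; rewrite mxE.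
have [_ -> _ _] := g4_bracketE (D 'e_0) 'e_2.
have [_ -> _ _] := g4_bracketE 'e_0 (D 'e_2).
exact: addr0.
Qed.

End G4.

Theorem theorem3p5 (R : realType) (lambda : R) (lambda_gt0 : 0 < lambda)
    (J : {linear 'rV[R]_4 -> 'rV[R]_4})
    (nabla : {bilinear 'rV[R]_4 -> 'rV[R]_4 -> 'rV[R]_4})
    (HJ : is_product_structure lambda J)
    (Hnabla : is_levi_civita (@g4_bracket R) (S1 lambda) nabla) :
  ~ first_kind_algebraic_ricci_soliton (@g4_bracket R) (S1 lambda)
      (v_frame lambda) (kobayashi_nomizu_connection nabla J).
Proof.
case=> c [D [derD /(_ 'e_3) ricE]].
have := ricci_e3_coord1 lambda_gt0 HJ Hnabla.
rewrite ricE mxE (derivation_e3_coord1 derD) !mxE /= mulr0 addr0.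
by apply/eqP; rewrite lt_eqF // mulr_gt0 ?invr_gt0 ?ltr0n // addr_gt0 ?invr_gt0.
Qed.
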